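(* There exist consistent path systems $\mathcal{P}$ for which $\Delta(\mathcal{P})$ is irrational.
   Context: Let $G=(V,E)$ be a finite connected (undirected, simple) graph. A consistent path system $\mathcal{P}$ in $G$ is a collection of simple paths in $G$ such that: (1) for every $u,v\in V$ there is a unique path $P_{u,v}\in\mathcal{P}$ connecting $u$ and $v$, with $P_{u,v}=P_{v,u}$ as undirected paths ($P_{u,u}$ being the trivial one-vertex path); (2) if $P\in\mathcal{P}$ and $x,y$ are vertices of $P$, then the $(xy)$-subpath of $P$ is $P_{x,y}\in\mathcal{P}$. For a metric $\rho$ on $V$ and a path $P=(x_0,\dots,x_k)$ put $\rho(P)=\sum_{i=1}^k\rho(x_{i-1},x_i)$. For real $\alpha\ge 1$, $\mathcal{P}$ is $\alpha$-metric if there is a metric $\rho$ on $V$ with $\rho(u,v)\le\rho(P_{u,v})\le\alpha\,\rho(u,v)$ for all $P_{u,v}\in\mathcal{P}$. Define $\Delta(\mathcal{P})=\inf\{\alpha\ge 1:\mathcal{P}\text{ is }\alpha\text{-metric}\}$. *)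

(* Defs.v *)
From HB Require Import structures.
From mathcomp Require Import all_boot all_order all_algebra.
From mathcomp Require Import boolp classical_sets reals.

Set Implicit Arguments.
Unset Strict Implicit.
Unset Printing Implicit Defensive.

Import Order.TTheory GRing.Theory Num.Theory.
Local Open Scope ring_scope.

(* A finite simple graph is an irreflexive symmetric adjacency relation [e] on
   a finite vertex type. *)
Record connected_graph (V : finType) (e : rel V) : Prop := ConnectedGraph {
  graph_sym : symmetric e;
  graph_irr : irreflexive e;
  graph_conn : forall u v : V, connect e u v }.

(* [s] lists, in order and endpoints included, the vertices of a simple path
   from [u] to [v]. *)
Definition simple_path (V : finType) (e : rel V) (u v : V) (s : seq V) : bool :=
  if s is x :: p then [&& x == u, path e x p, last x p == v & uniq (x :: p)]
  else false.

(* A path system is encoded by the map sending (u, v) to its unique path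
   P_{u,v}, oriented from u to v; [cps_rev] says that P_{u,v} and P_{v,u} are
   the same undirected path.  As P_{u,v} is simple, its (xy)-subpath, for x
   occurring no later than y, is the contiguous subsequence x :: q of P_{u,v}
   with last x q = y; the other order of x and y follows by [cps_rev]. *)
Record consistent_path_system (V : finType) (e : rel V) (P : V -> V -> seq V) :
    Prop := ConsistentPathSystem {
  cps_path : forall u v : V, simple_path e u v (P u v);
  cps_rev : forall u v : V, P v u = rev (P u v);
  cps_sub : forall (u v x : V) (q : seq V),
    infix (x :: q) (P u v) -> x :: q = P x (last x q) }.

Record is_metric (R : realType) (V : Type) (rho : V -> V -> R) : Prop :=
    IsMetric {
  metric_ge0 : forall x y : V, 0 <= rho x y;
  metric_eq0 : forall x y : V, rho x y = 0 <-> x = y;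
  metric_sym : forall x y : V, rho x y = rho y x;
  metric_triangle : forall x y z : V, rho x z <= rho x y + rho y z }.

Definition path_length (R : realType) (V : Type) (rho : V -> V -> R)
    (s : seq V) : R :=
  \sum_(xy <- zip s (behead s)) rho xy.1 xy.2.

Definition alpha_metric (R : realType) (V : finType) (P : V -> V -> seq V)
    (alpha : R) : Prop :=
  exists rho : V -> V -> R, is_metric rho /\
    forall u v : V, rho u v <= path_length rho (P u v) /\
                    path_length rho (P u v) <= alpha * rho u v.

(* The set is nonempty (the discrete metric shows that alpha = #|V| + 1 is
   admissible) and bounded below, so the total operator [inf] is the genuine
   infimum here. *)
Definition Delta (R : realType) (V : finType) (P : V -> V -> seq V) : R :=
  inf [set alpha : R | 1 <= alpha /\ alpha_metric P alpha]%classic.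

(* Main.v *)
Require Import Defs.
From mathcomp Require Import all_boot all_order all_algebra.
From mathcomp Require Import boolp classical_sets reals.
From mathcomp Require Import ring lra.

(** The example lives on the cone over a circulant graph: the vertices are the
residues mod 17 together with a hub adjacent to all of them, and two residues
are adjacent when they differ by a or b up to sign, where a = 1 and b = -5.
The paths between residues are the translates of the words
  a, b, aa, ab, bb, aab, abb
and their reverses; every other pair of residues, namely those that differ by
a - b up to sign, is joined through the hub.  The eight elements a, b, 2a,
a + b, 2b, 2a + b, a + 2b, a - b represent each nonzero residue exactly once
up to sign.  So each pair of vertices gets one path, and the endpoints of aab
and abb are at distance 3 in the circulant graph.

The infimum is the square root s of 3/2.

Lower bound.  Let rho witness alpha, and let A, B and S be the sums over all x
of rho (x, x + a), rho (x, x + b) and rho (hub, x).  Comparing the paths aab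
and abb with the detours through the hub, and the paths through the hub with
the detours x + b, x, x + a, and summing over all translates gives
  2A + B <= 2 alpha S,   A + 2B <= 2 alpha S,   2S <= alpha (A + B).
Hence 3 (A + B) <= 4 alpha S <= 2 alpha^2 (A + B), and alpha^2 >= 3/2
([alpha_metric_sqr_ge], where A and B are E a and E b).

Upper bound.  Give the edges between residues length 1 and the spokes length s.
A path of three edges then has length 3 = s * 2s against the detour 2s through
the hub, while a path through the hub has length 2s against a detour of length
2: both ratios are s, and no other pair is worse ([alpha_metric_ratio]).  So
all inequalities of the lower bound are tight, and s is attained.

Statements about the finite system alone are decided by evaluation. *)

Set Implicit Arguments.
Unset Strict Implicit.
Unset Printing Implicit Defensive.

Import Order.TTheory GRing.Theory Num.Theory.
Local Open Scope ring_scope.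

(** * The path system *)

Definition vertex : finType := option 'Z_17.
Definition hub : vertex := None.

Definition a : 'Z_17 := 1.
Definition b : 'Z_17 := - 5%:R.
Definition steps : seq 'Z_17 := [:: a; b; - a; - b].

Definition adj (u v : vertex) : bool :=
  match u, v with
  | None, None => false
  | Some x, Some y => y - x \in steps
  | _, _ => true
  end.

Definition words : seq (seq 'Z_17) :=
  [:: [:: a]; [:: b]; [:: a; a]; [:: a; b]; [:: b; b];
      [:: a; a; b]; [:: a; b; b]].

(** The empty word is there for the trivial paths. *)
Definition routes : seq (seq 'Z_17) :=
  [::] :: words ++ [seq rev [seq - x | x <- w] | w <- words].

Definition route (d : 'Z_17) : option (seq 'Z_17) :=
  ohead [seq w <- routes | foldr +%R 0 w == d].

Definition pathsys (u v : vertex) : seq vertex :=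
  match u, v with
  | None, None => [:: hub]
  | Some x, Some y =>
      if route (y - x) is Some w then [seq Some z | z <- x :: scanl +%R x w]
      else [:: u; hub; v]
  | _, _ => [:: u; v]
  end.

(** * Deciding statements about residues and vertices *)

(** Explicit lists evaluate, whereas the enumeration of a finite type of
ordinals matches on opaque proofs. *)
Definition residues : seq 'Z_17 := [seq inZp i | i <- iota 0 17].
Definition vertices : seq vertex := hub :: [seq Some x | x <- residues].

Lemma mem_residues (x : 'Z_17) : x \in residues.
Proof.
apply/mapP; exists (val x); last by rewrite valZpK.
by rewrite mem_iota; apply: ltn_ord.
Qed.

Lemma mem_vertices (v : vertex) : v \in vertices.
Proof.
case: v => [x|]; last by rewrite inE.
by rewrite inE; apply/orP; right; apply: map_f; apply: mem_residues.
Qed.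

Lemma all_residuesP (p : pred 'Z_17) : all p residues -> forall x, p x.
Proof. by move=> /allP h x; apply/h/mem_residues. Qed.

Lemma all_verticesP (p : pred vertex) : all p vertices -> forall v, p v.
Proof. by move=> /allP h v; apply/h/mem_vertices. Qed.

Lemma all_vertices2P (p : rel vertex) :
  all (fun u => all (p u) vertices) vertices -> forall u v, p u v.
Proof. by move=> h u v; apply: all_verticesP; apply: (all_verticesP h). Qed.

Lemma all_vertices3P (p : vertex -> rel vertex) :
  all (fun u => all (fun v => all (p u v) vertices) vertices) vertices ->
  forall u v w, p u v w.
Proof. by move=> h u; apply: all_vertices2P; apply: (all_verticesP h). Qed.

(** * Consistency *)

Lemma adj_connected : connected_graph adj.
Proof.
split.
- move=> u v; apply/eqP; move: u v.
  by apply: (all_vertices2P (p := fun u v => adj u v == adj v u)); vm_compute.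
- move=> u; apply/negbTE; move: u.
  by apply: (all_verticesP (p := fun u => ~~ adj u u)); vm_compute.
- move=> u v; apply: (@connect_trans _ _ hub).
    by case: u => [x|]; [apply: connect1 | apply: connect0].
  by case: v => [x|]; [apply: connect1 | apply: connect0].
Qed.

(** Every vertex sequence of a path in this system has at most four entries, so
its contiguous subsequences are cut out by indices below 5. *)
Definition subpaths_ok (u v : vertex) : bool :=
  all (fun i => all (fun j =>
    if take j (drop i (pathsys u v)) is x :: q
    then x :: q == pathsys x (last x q) else true) (iota 0 5)) (iota 0 5).

Lemma pathsys_consistent : consistent_path_system adj pathsys.
Proof.
split.
- by apply: all_vertices2P; vm_compute.
- move=> u v; apply/eqP; move: u v.
  by apply: (all_vertices2P (p := fun u v => pathsys v u == rev (pathsys u v)));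
    vm_compute.
move=> u v x q /infixP[s [s' def_uv]].
have size_le4 : (size (pathsys u v) < 5)%N.
  move: u v {def_uv}.
  by apply: (all_vertices2P (p := fun u v => (size (pathsys u v) < 5)%N));
    vm_compute.
have : subpaths_ok u v.
  by move: u v {def_uv size_le4}; apply: all_vertices2P; vm_compute.
have size_s : (size s < 5)%N.
  by apply: leq_ltn_trans size_le4; rewrite def_uv size_cat leq_addr.
have size_q : (size (x :: q) < 5)%N.
  apply: leq_ltn_trans size_le4.
  by rewrite def_uv !size_cat addnCA leq_addr.
move=> /allP/(_ (size s)); rewrite mem_iota => /(_ size_s).
move=> /allP/(_ (size (x :: q))); rewrite mem_iota => /(_ size_q).
by rewrite def_uv drop_size_cat // take_size_cat // => /eqP.
Qed.

(** * The lower bound *)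

Section LowerBound.
Variable R : realType.

(** All three families of inequalities in the lower bound are instances of this
comparison with a two-step detour. *)
Lemma path_length_le_detour (rho : vertex -> vertex -> R) (alpha : R) u v w :
  is_metric rho -> 0 <= alpha ->
  path_length rho (pathsys u v) <= alpha * rho u v ->
  path_length rho (pathsys u v) <= alpha * (rho u w + rho w v).
Proof.
move=> rho_metric alpha_ge0 /le_trans; apply.
by rewrite ler_wpM2l // metric_triangle.
Qed.

Lemma sum_translate (f : 'Z_17 -> R) (d : 'Z_17) :
  \sum_x f (x + d) = \sum_x f x.
Proof. by rewrite [RHS](reindex_inj (addIr d)). Qed.

(** A metric has 34 edge lengths between residues and 17 spoke lengths, with no
symmetry assumed.  Summing each inequality over its translates leaves only the
three totals E a, E b and S. *)
Lemma alpha_metric_sqr_ge (alpha : R) :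
  1 <= alpha -> alpha_metric pathsys alpha -> 3 / 2 <= alpha ^+ 2.
Proof.
move=> alpha_ge1 [rho [rho_metric rhoP]].
have alpha_ge0 : 0 <= alpha by lra.
have detour u v w :
    path_length rho (pathsys u v) <= alpha * (rho u w + rho w v).
  by apply: path_length_le_detour => //; have [] := rhoP u v.
pose E (d : 'Z_17) := \sum_x rho (Some x) (Some (x + d)).
pose S := \sum_x rho hub (Some x).
have rhoC := metric_sym rho_metric.
have word_le c d e :
    (forall x, pathsys (Some x) (Some (x + c + d + e)) =
      [:: Some x; Some (x + c); Some (x + c + d); Some (x + c + d + e)]) ->
    E c + E d + E e <= alpha * (S + S).
  move=> pathE.
  rewrite -[E e](sum_translate _ d) -[E d](sum_translate _ c).
  rewrite -[X in _ + X](sum_translate _ c) -[X in S + X](sum_translate _ e).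
  rewrite -[X in S + X](sum_translate _ d) -[X in S + X](sum_translate _ c).
  rewrite -!big_split mulr_sumr ler_sum //= => x _.
  have := detour (Some x) (Some (x + c + d + e)) hub.
  rewrite pathE /path_length /= !big_cons big_nil addr0 /= (rhoC (Some x) hub).
  by rewrite addrA.
have aab_le : E a + E a + E b <= alpha * (S + S).
  apply: word_le => x; apply/eqP; move: x.
  by apply: all_residuesP; vm_compute.
have abb_le : E a + E b + E b <= alpha * (S + S).
  apply: word_le => x; apply/eqP; move: x.
  by apply: all_residuesP; vm_compute.
(* x + b and x + a differ by a - b, so their path goes through the hub, while
both are neighbours of x. *)
have hub_le : S + S <= alpha * (E b + E a).
  rewrite -{1}[S](sum_translate _ b) -[S in X in _ + X <= _](sum_translate _ a).
  rewrite -!big_split mulr_sumr ler_sum //= => x _.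
  have pathE : pathsys (Some (x + b)) (Some (x + a)) =
      [:: Some (x + b); hub; Some (x + a)].
    by apply/eqP; move: x; apply: all_residuesP; vm_compute.
  have := detour (Some (x + b)) (Some (x + a)) (Some x).
  rewrite pathE /path_length /= !big_cons big_nil addr0 /=.
  by rewrite (rhoC (Some (x + b)) hub) (rhoC (Some (x + b)) (Some x)).
have E_gt0 : 0 < E a + E b.
  have E_ge0 d : 0 <= E d by apply: sumr_ge0 => x _; apply: metric_ge0.
  rewrite ltr_pwDl // lt_neqAle E_ge0 andbT eq_sym /E psumr_neq0; last first.
    by move=> x _; apply: metric_ge0.
  apply/hasP; exists 0; first exact: mem_index_enum.
  rewrite /= lt_neqAle metric_ge0 // andbT eq_sym.
  by apply/eqP => /(metric_eq0 rho_metric).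
have : 3 * (E a + E b) <= 2 * alpha ^+ 2 * (E a + E b).
  have : alpha * (S + S) <= alpha * (alpha * (E b + E a)) by rewrite ler_wpM2l.
  by rewrite expr2; lra.
by rewrite ler_pM2r //; lra.
Qed.

End LowerBound.

(** * The optimal metric *)

(** The pair (p, q) stands for the length p + q s.  The distance of two residues
is the smaller of their distance in the circulant graph and the length 2s of the
detour through the hub; since 2 < 2s < 3, the latter takes over exactly from
distance 3 on. *)
Definition dist (u v : vertex) : nat * nat :=
  match u, v with
  | None, None => (0, 0)%N
  | Some x, Some y =>
      if x == y then (0, 0)%N
      else if y - x \in steps then (1, 0)%N
      else if y - x \in [seq c + d | c <- steps, d <- steps] then (2, 0)%N
      else (0, 2)%N
  | _, _ => (0, 1)%N
  end.

Definition addl (c d : nat * nat) : nat * nat := (c.1 + d.1, c.2 + d.2)%N.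

(** As s lies between 6/5 and 5/4, an inequality between lengths, being affine
in s, holds as soon as it holds at both of these values. *)
Definition lel (c d : nat * nat) : bool :=
  (5 * c.1 + 6 * c.2 <= 5 * d.1 + 6 * d.2)%N &&
  (4 * c.1 + 5 * c.2 <= 4 * d.1 + 5 * d.2)%N.

Definition plen (t : seq vertex) : nat * nat :=
  foldr addl (0, 0)%N [seq dist uv.1 uv.2 | uv <- zip t (behead t)].

Section UpperBound.
Variable R : realType.

Definition s : R := Num.sqrt (3 / 2).

Lemma sqr_s : s ^+ 2 = 3 / 2.
Proof. by rewrite sqr_sqrtr //; lra. Qed.

Lemma s_bounds : 6 / 5 <= s <= 5 / 4.
Proof.
have s_ge0 : 0 <= s by apply: sqrtr_ge0.
have := sqr_s; rewrite expr2 => s2.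
by apply/andP; split; nra.
Qed.

Definition length_of (c : nat * nat) : R := c.1%:R + c.2%:R * s.

Lemma length_ofD c d : length_of (addl c d) = length_of c + length_of d.
Proof. by rewrite /length_of /= !natrD; ring. Qed.

Lemma length_of_le c d : lel c d -> length_of c <= length_of d.
Proof.
case: c d => [p q] [p' q'] /andP[/=]; have /andP[s_ge s_le] := s_bounds.
rewrite -!(ler_nat R) !(natrM, natrD) /length_of /= => le65 le54.
(* The difference of the two sides at s is a combination of its values at 6/5
and 5/4, with weights proportional to the distances from s to 5/4 and 6/5. *)
have ge65 : 0 <= (5 - 4 * s) *
    (5 * p'%:R + 6 * q'%:R - (5 * p%:R + 6 * q%:R)) by apply: mulr_ge0; lra.
have ge54 : 0 <= (5 * s - 6) *
    (4 * p'%:R + 5 * q'%:R - (4 * p%:R + 5 * q%:R)) by apply: mulr_ge0; lra.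
by rewrite -subr_ge0; apply: le_trans (addr_ge0 ge65 ge54) _; lra.
Qed.

Definition rho (u v : vertex) : R := length_of (dist u v).

Lemma path_length_rho t : path_length rho t = length_of (plen t).
Proof.
rewrite /path_length /plen; elim: (zip _ _) => [|uv r IHr] /=.
  by rewrite big_nil /length_of /= mul0r addr0.
by rewrite big_cons IHr length_ofD.
Qed.

Lemma rho_metric : is_metric rho.
Proof.
split.
- by move=> u v; rewrite addr_ge0 // mulr_ge0 // sqrtr_ge0.
- move=> u v; split=> [rho0|->]; last first.
    rewrite /rho; have -> : dist v v = (0, 0)%N.
      apply/eqP; move: v.
      apply: (all_verticesP (p := fun v => dist v v == (0, 0)%N)).
      by vm_compute.
    by rewrite /length_of mul0r addr0.
  apply/eqP.
  have : (u == v) || lel (1, 0)%N (dist u v).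
    move: u v {rho0}.
    apply: (all_vertices2P (p := fun u v =>
      (u == v) || lel (1, 0)%N (dist u v))).
    by vm_compute.
  by case/orP => // /length_of_le; rewrite -/(rho u v) rho0 /length_of /=; lra.
- move=> u v; rewrite /rho; congr length_of; apply/eqP; move: u v.
  by apply: (all_vertices2P (p := fun u v => dist u v == dist v u)); vm_compute.
- move=> u v w; rewrite -length_ofD; apply: length_of_le; move: u v w.
  apply: (all_vertices3P (p := fun u v w =>
    lel (dist u w) (addl (dist u v) (dist v w)))).
  by vm_compute.
Qed.

Lemma alpha_metric_ratio : alpha_metric pathsys s.
Proof.
exists rho; split=> [|u v]; first exact: rho_metric.
rewrite path_length_rho; split.
  apply: length_of_le; move: u v.
  apply: (all_vertices2P (p := fun u v => lel (dist u v) (plen (pathsys u v)))).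
  by vm_compute.
(* As 2 s^2 = 3, twice s (p + q s) is 3q + 2p s. *)
have : lel (addl (plen (pathsys u v)) (plen (pathsys u v)))
           (3 * (dist u v).2, 2 * (dist u v).1)%N.
  move: u v.
  apply: (all_vertices2P (p := fun u v =>
    lel (addl (plen (pathsys u v)) (plen (pathsys u v)))
      (3 * (dist u v).2, 2 * (dist u v).1)%N)).
  by vm_compute.
move=> /length_of_le; rewrite length_ofD /rho.
rewrite [X in _ <= X -> _]/length_of [X in _ -> _ <= _ * X]/length_of /= !natrM.
have := sqr_s; rewrite expr2.
set p := (dist u v).1%:R; set q := (dist u v).2%:R => s2 h.
have -> : s * (p + q * s) = s * p + q * (s * s) by ring.
by rewrite s2; lra.
Qed.

(** * The infimum *)

Lemma Delta_eq : Delta R pathsys = s.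
Proof.
have s_ge1 : 1 <= s by have /andP[] := s_bounds; lra.
have lb_s :
    lbound [set alpha : R | 1 <= alpha /\ alpha_metric pathsys alpha]%classic s.
  move=> alpha [alpha_ge1 alphaP].
  rewrite -ler_sqr ?nnegrE ?sqr_s; [exact: alpha_metric_sqr_ge | lra | lra].
apply/eqP; rewrite eq_le; apply/andP; split.
  apply: ge_inf; first by exists s.
  by split; [exact: s_ge1 | exact: alpha_metric_ratio].
apply: lb_le_inf => //; exists s.
by split; [exact: s_ge1 | exact: alpha_metric_ratio].
Qed.

(** If s = m / n then 2 m^2 = 3 n^2, but the exponent of 2 is odd on the left
and even on the right. *)
Lemma s_irrational : irrational s.
Proof.
move=> /rationalP[m [n s_mn]].
have := sqr_s; have /andP[s_ge _] := s_bounds; rewrite s_mn in s_ge *.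
have n_gt0 : (0 < n)%N.
  by rewrite lt0n; apply/eqP => n0; move: s_ge; rewrite n0 invr0 mulr0; lra.
have m_gt0 : (0 < `|m|)%N.
  by rewrite absz_gt0; apply/eqP => m0; move: s_ge; rewrite m0 mul0r; lra.
rewrite expr_div_n => /eqP; rewrite eqr_div ?expf_neq0 ?pnatr_eq0 -?lt0n //.
rewrite -rmorphXn /= -[(m ^+ 2)%R]gez0_abs ?sqr_ge0 // abszX.
rewrite -[in 3 * _]natrX -!natrM eqr_nat => /eqP/(congr1 (logn 2)).
rewrite !lognM ?muln_gt0 ?m_gt0 ?n_gt0 // => /(congr1 odd).
by rewrite !oddD !addbb.
Qed.

End UpperBound.

Theorem theorem5p2 (R : realType) :
  exists (V : finType) (e : rel V) (P : V -> V -> seq V),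
    [/\ connected_graph e,
        consistent_path_system e P
      & irrational (Delta R P)].
Proof.
exists vertex, adj, pathsys; split.
- exact: adj_connected.
- exact: pathsys_consistent.
- by rewrite Delta_eq; apply: s_irrational.
Qed.
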